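(* Let $n$ be any positive integer, let $B$ be a fork with $n$ vertices and point of return $r$, and let $A$ be the GIM associated to $B$ and the linear ordering $r\prec a_{n-1}\prec a_{n-2}\prec\dots\prec a_1$, where $a_1,\dots,a_{n-1}$ are the vertices of $B\setminus\{r\}$ listed so that every arrow $a_s\to a_t$ has $s<t$. For each fork-preserving mutation sequence $\boldsymbol{w}$ from $B$, the GIM $A^{\boldsymbol{w}}$ is admissible for $B^{\boldsymbol{w}}$.
   Context: A quiver on the vertex set $\{1,\dots,n\}$ (no loops, no oriented 2-cycles) is identified with an $n\times n$ skew-symmetric integer matrix $B=[b_{ij}]$: if $b_{ij}>0$ there are $b_{ij}$ arrows from $i$ to $j$. Mutation: for an $n\times 2n$ integer matrix $M=[m_{ij}]$ and $k\in\{1,\dots,n\}$, the mutation of $M$ at $k$ is the matrix with entries $-m_{ij}$ if $i=k$ or $j=k$, and $m_{ij}+\mathrm{sgn}(m_{ik})\max(m_{ik}m_{kj},0)$ otherwise. A mutation sequence $\boldsymbol{w}=[i_1,\dots,i_\ell]$ (possibly empty) means mutating at $i_1$, then $i_2$, etc.; $\boldsymbol{w}[k]$ is $\boldsymbol{w}$ followed by $k$; $\boldsymbol{w}$ is reduced if $i_j\ne i_{j+1}$ for all $j$. Starting from $[B\mid I]$, the result after $\boldsymbol{w}$ is written $[B^{\boldsymbol{w}}\mid C^{\boldsymbol{w}}]$ with $B^{\boldsymbol{w}}=[b_{ij}^{\boldsymbol{w}}]$; the rows $c_i^{\boldsymbol{w}}$ of $C^{\boldsymbol{w}}$ are the $c$-vectors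 (known to be nonzero, with all nonzero entries of one sign, denoted $\mathrm{sgn}(c_i^{\boldsymbol{w}})\in\{1,-1\}$). A quiver is abundant if there are at least two arrows between every pair of distinct vertices. A fork is an abundant, non-acyclic quiver $F=[f_{ij}]$ with a vertex $r$ (the point of return, which is unique) such that, with $F^-(r)$ the set of vertices having arrows to $r$ and $F^+(r)$ the set of vertices receiving arrows from $r$: for all $i\in F^-(r)$, $j\in F^+(r)$ one has $f_{ji}>f_{ir}$ and $f_{ji}>f_{rj}$; and the full subquivers on $F^-(r)$ and on $F^+(r)$ are acyclic. Then $F\setminus\{r\}$ is acyclic. A fork-preserving mutation sequence from a fork with point of return $r$ is a reduced mutation sequence whose first mutation (if any) is not at $r$. A generalized intersection matrix (GIM) is a square integer matrix $A=[a_{ij}]$ with $a_{ii}=2$, $a_{ij}>0\iff a_{ji}>0$, and $a_{ij}<0\iff a_{ji}<0$. The GIM associated to $B$ and a linear ordering $\prec$ on $\{1,\dots,n\}$ is the symmetric matrix with $a_{ij}=b_{ij}$ if $i\prec j$, $a_{ii}=2$, $a_{ij}=-b_{ij}$ if $i\succ j$. A (symmetric) GIM $A$ with $|a_{ij}|=|b_{ij}|$ for all $i\ne j$ is admissible for $B$ if for every chordless cycle $Z$ in the quiver of $B$ (a cycle of the underlying graph with no chords), the product $\prod_{(i,j)\in Z}(-a_{ij})$ over the edges of $Z$ is negative if $Z$ is oriented and positive otherwise. Mutation of GIMs: $A^{[\,]}=A$, and $A^{\boldsymbol{w}[k]}$ is obtained from $A^{\boldsymbol{w}}=[a^{\boldsymbol{w}}_{ij}]$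 by: $a_{ik}^{\boldsymbol{w}[k]}=-\mathrm{sgn}(b_{ik}^{\boldsymbol{w}})\,\mathrm{sgn}(c_k^{\boldsymbol{w}})\,a_{ik}^{\boldsymbol{w}}$ for $i\ne k$; $a_{kj}^{\boldsymbol{w}[k]}=-\mathrm{sgn}(b_{jk}^{\boldsymbol{w}})\,\mathrm{sgn}(c_k^{\boldsymbol{w}})\,a_{kj}^{\boldsymbol{w}}$ for $j\ne k$; and $a_{ij}^{\boldsymbol{w}[k]}=a_{ij}^{\boldsymbol{w}}-\mathrm{sgn}(a_{ik}^{\boldsymbol{w}}a_{kj}^{\boldsymbol{w}})\max(b_{ik}^{\boldsymbol{w}}b_{kj}^{\boldsymbol{w}},0)$ in all other cases. *)

(* Defs.v *)
From mathcomp Require Import all_boot all_order all_algebra.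
Set Implicit Arguments.
Unset Strict Implicit.
Unset Printing Implicit Defensive.
Import Order.TTheory GRing.Theory Num.Theory.
Local Open Scope ring_scope.

(* A quiver on 'I_n is a skew-symmetric integer matrix B; there are B i j
   arrows from i to j when B i j is positive. *)
Definition skew_symmetric (n : nat) (B : 'M[int]_n) : Prop :=
  forall i j, B j i = - B i j.

Definition arrow (n : nat) (B : 'M[int]_n) : rel 'I_n :=
  fun i j => 0 < B i j.

Definition adjacent (n : nat) (B : 'M[int]_n) : rel 'I_n :=
  fun i j => B i j != 0.

(* The full subquiver of B on S has no oriented cycle; the empty sequence is
   excluded because MathComp's [cycle e [::]] holds. *)
Definition acyclic_on (n : nat) (B : 'M[int]_n) (S : {set 'I_n}) : Prop :=
  forall s : seq 'I_n,
    s != [::] -> {subset s <= S} -> ~ cycle (arrow B) s.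

Definition acyclic (n : nat) (B : 'M[int]_n) : Prop := acyclic_on B [set: 'I_n].

Definition abundant (n : nat) (B : 'M[int]_n) : Prop :=
  forall i j, i != j -> 2 <= `|B i j|.

Definition in_nbr (n : nat) (B : 'M[int]_n) (r : 'I_n) : {set 'I_n} :=
  [set i | arrow B i r].

Definition out_nbr (n : nat) (B : 'M[int]_n) (r : 'I_n) : {set 'I_n} :=
  [set j | arrow B r j].

Definition fork (n : nat) (F : 'M[int]_n) (r : 'I_n) : Prop :=
  [/\ skew_symmetric F,
      abundant F,
      ~ acyclic F,
      (forall i j, i \in in_nbr F r -> j \in out_nbr F r ->
         F i r < F j i /\ F r j < F j i)
    & acyclic_on F (in_nbr F r) /\ acyclic_on F (out_nbr F r)].

(* M stands for [B | C]: the index k of a mutation is a row, and also the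
   column [lshift n k] of the left half. *)
Definition mutate (n : nat) (M : 'M[int]_(n, n + n)) (k : 'I_n)
  : 'M[int]_(n, n + n) :=
  \matrix_(i, j)
    if (i == k) || (j == lshift n k) then - M i j
    else M i j + Num.sg (M i (lshift n k))
                 * Num.max (M i (lshift n k) * M k j) 0.

Definition framed (n : nat) (B : 'M[int]_n) : 'M[int]_(n, n + n) :=
  row_mx B 1%:M.

Definition Bmut (n : nat) (B : 'M[int]_n) (w : seq 'I_n) : 'M[int]_n :=
  lsubmx (foldl (@mutate n) (framed B) w).

Definition Cmut (n : nat) (B : 'M[int]_n) (w : seq 'I_n) : 'M[int]_n :=
  rsubmx (foldl (@mutate n) (framed B) w).

Definition reduced (n : nat) (w : seq 'I_n) : bool :=
  sorted (fun i j => i != j) w.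

Definition fork_preserving (n : nat) (r : 'I_n) (w : seq 'I_n) : bool :=
  reduced w && (ohead w != Some r).

(* The common sign of the nonzero entries of a nonzero sign-coherent vector.
   c-vectors are always of this kind; 0 is a junk value for other vectors. *)
Definition vsgn (n : nat) (v : 'rV[int]_n) : int :=
  if v == 0 then 0
  else if [forall j, 0 <= v 0 j] then 1
  else if [forall j, v 0 j <= 0] then -1
  else 0.

Definition GIM (n : nat) (A : 'M[int]_n) : Prop :=
  [/\ forall i, A i i = 2,
      forall i j, 0 < A i j <-> 0 < A j i
    & forall i j, A i j < 0 <-> A j i < 0].

Definition gim_of (n : nat) (B : 'M[int]_n) (prec : rel 'I_n) : 'M[int]_n :=
  \matrix_(i, j) if i == j then 2 else if prec i j then B i j else - B i j.

Definition seq_order (T : eqType) (l : seq T) : rel T :=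
  fun x y => (index x l < index y l)%N.

Definition gim_mutate (n : nat) (B C A : 'M[int]_n) (k : 'I_n) : 'M[int]_n :=
  \matrix_(i, j)
    if (i != k) && (j == k) then
      - Num.sg (B i k) * vsgn (row k C) * A i k
    else if (i == k) && (j != k) then
      - Num.sg (B j k) * vsgn (row k C) * A k j
    else A i j - Num.sg (A i k * A k j) * Num.max (B i k * B k j) 0.

Fixpoint gim_mutations (n : nat) (M : 'M[int]_(n, n + n)) (A : 'M[int]_n)
    (w : seq 'I_n) : 'M[int]_n :=
  if w is k :: w' then
    gim_mutations (mutate M k) (gim_mutate (lsubmx M) (rsubmx M) A k) w'
  else A.

Definition Amut (n : nat) (B A : 'M[int]_n) (w : seq 'I_n) : 'M[int]_n :=
  gim_mutations (framed B) A w.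

(* A cycle of the underlying graph is given by its distinct vertices, listed
   in cyclic order in either direction. *)
Definition chordless_cycle (n : nat) (B : 'M[int]_n) (s : seq 'I_n) : Prop :=
  [/\ (2 < size s)%N, ucycle (adjacent B) s
    & forall x y, x \in s -> y \in s -> adjacent B x y ->
        y = next s x \/ x = next s y].

Definition oriented (n : nat) (B : 'M[int]_n) (s : seq 'I_n) : bool :=
  cycle (arrow B) s || cycle (arrow B) (rev s).

Definition admissible (n : nat) (B A : 'M[int]_n) : Prop :=
  [/\ GIM A,
      A^T = A,
      forall i j, i != j -> `|A i j| = `|B i j|
    & forall s, chordless_cycle B s ->
        if oriented B s then \prod_(x <- s) (- A x (next s x)) < 0
        else 0 < \prod_(x <- s) (- A x (next s x))].

Definition source_listing (n : nat) (B : 'M[int]_n) (r : 'I_n) (a : seq 'I_n)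
  : Prop :=
  [/\ uniq a, a =i predC1 r
    & {in a &, forall x y, arrow B x y -> (index x a < index y a)%N}].

(* Main.v *)
(* Mutating a fork at k, other than its point of return r, gives a fork with
   point of return k in whose complement of k the vertex r is a source or a sink
   and all other arrows keep their direction.  All quivers met are therefore
   abundant, so every chordless cycle is a triangle, and one shows inductively
   that A^w is, up to changing the signs of basis vectors, the GIM of B^w for a
   linear order starting at the current point of return; the GIM mutation rule
   respects such sign changes, and the admissibility of this GIM is read off the
   fork inequalities.

   The signs of the c-vectors enter only as a change of signs of basis vectors,
   but they must be nonzero.  Sign-coherence is proved along the way: off the
   point of return r, in the acyclic order, the positive c-vectors come before
   the negative ones, and after the first mutation c_r is entrywise dominated by
   each c-vector that could be added to it with the opposite sign; as all
   multiplicities are at least 2, such an addition flips the sign of c_r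
   without breaking coherence. *)
Require Import Defs.
From mathcomp Require Import all_boot all_order all_algebra.
From mathcomp Require Import zify ring.
Set Implicit Arguments.
Unset Strict Implicit.
Unset Printing Implicit Defensive.
Import Order.TTheory GRing.Theory Num.Theory.
Local Open Scope ring_scope.

(** * Mutation of the two blocks of [[B | C]] *)

Definition quiver_mut n (B : 'M[int]_n) (k : 'I_n) : 'M[int]_n :=
  \matrix_(i, j) if (i == k) || (j == k) then - B i j
    else B i j + Num.sg (B i k) * Num.max (B i k * B k j) 0.

Definition coef_mut n (B C : 'M[int]_n) (k : 'I_n) : 'M[int]_n :=
  \matrix_(i, j) if i == k then - C i j
    else C i j + Num.sg (B i k) * Num.max (B i k * C k j) 0.

Lemma lsubmx_mutate n (M : 'M[int]_(n, n + n)) k :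
  lsubmx (mutate M k) = quiver_mut (lsubmx M) k.
Proof. by apply/matrixP => i j; rewrite !mxE (inj_eq (@lshift_inj _ _)). Qed.

Lemma rsubmx_mutate n (M : 'M[int]_(n, n + n)) k :
  rsubmx (mutate M k) = coef_mut (lsubmx M) (rsubmx M) k.
Proof. by apply/matrixP => i j; rewrite !mxE eq_rlshift orbF. Qed.

(** * Forks under mutation away from the point of return *)

(* What survives of the definition of a fork: it need not contain an oriented
   cycle, and acyclicity off [r] is recorded as transitivity of the arrows. *)
Record prefork n (B : 'M[int]_n) (r : 'I_n) : Prop := Prefork {
  prefork_skew : skew_symmetric B;
  prefork_abundant : abundant B;
  prefork_trans : forall i j l, i != r -> j != r -> l != r ->
    0 < B i j -> 0 < B j l -> 0 < B i l;
  prefork_return : forall i j, 0 < B i r -> 0 < B r j ->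
    B i r < B j i /\ B r j < B j i }.

Lemma skew_diag n (B : 'M[int]_n) i : skew_symmetric B -> B i i = 0.
Proof. by move=> /(_ i i); lia. Qed.

Section Prefork.
Variables (n : nat) (B : 'M[int]_n) (r k : 'I_n).
Hypotheses (Br : prefork B r) (kr : k != r).
Let B' := quiver_mut B k.

Lemma quiver_mutE i j : i != k -> j != k ->
  B' i j = B i j + Num.sg (B i k) * Num.max (B i k * B k j) 0.
Proof. by move=> ik jk; rewrite mxE (negbTE ik) (negbTE jk). Qed.

Lemma quiver_mutl j : B' k j = - B k j.
Proof. by rewrite mxE eqxx. Qed.

Lemma quiver_mutr i : B' i k = - B i k.
Proof. by rewrite mxE eqxx orbT. Qed.

Lemma quiver_mut_skew : skew_symmetric B'.
Proof.
move=> i j; have sk := prefork_skew Br.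
have [->|ik] := eqVneq i k; first by rewrite quiver_mutl quiver_mutr (sk k j);
  lia.
have [->|jk] := eqVneq j k; first by rewrite quiver_mutl quiver_mutr (sk i k);
  lia.
rewrite !quiver_mutE // (sk i j) (sk k j) (sk i k).
by have := sk j k; nia.
Qed.

(** Off [r] arrows are transitive, so a path through [k] only reinforces an arrow already present
    and nothing cancels. *)
Lemma quiver_mut_acyclic i j : i != r -> j != r -> i != k -> j != k -> i != j ->
  `|B' i j| = `|B i j| + Num.max (B i k * B k j) 0 /\
  (0 < B' i j) = (0 < B i j).
Proof.
move=> ir jr ik jk ij; rewrite !quiver_mutE //.
have T := @prefork_trans _ _ _ Br.
have := T _ _ _ ir kr jr; have := T _ _ _ jr kr ir.
have := prefork_abundant Br ij.
have := prefork_skew Br i j; have := prefork_skew Br i k.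
have := prefork_skew Br k j.
move: (B i j) (B j i) (B i k) (B k i) (B k j) (B j k) => x x' y y' z z' -> ->
  ->.
nia.
Qed.

(* After mutating at [k], the former point of return is a source or a sink of
   the complement of [k]. *)
Lemma quiver_mut_return j : j != r -> j != k ->
  2 <= `|B' r j| /\ (0 < B' r j) = (0 < B r k).
Proof.
move=> jr jk; have rk : r != k by rewrite eq_sym.
have rj : r != j by rewrite eq_sym.
rewrite !quiver_mutE //.
(* If [r] lies on a path between [j] and [k], the triangle is oriented and its side between [j] and
   [k] exceeds [|B r j|]; multiplied by [|B r k|], at least 2, it reverses the arrows at [r] with at
   least 2 left over. *)
have R := prefork_return Br.
have := R j k; have := R k j.
have := prefork_abundant Br rj; have := prefork_abundant Br rk.
have := prefork_skew Br r j; have := prefork_skew Br r k.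
have := prefork_skew Br k j.
move: (B r j) (B j r) (B r k) (B k r) (B k j) (B j k) => x x' y y' z z' -> ->
  ->.
nia.
Qed.

Lemma prefork_mut : prefork B' k.
Proof.
have sk' := quiver_mut_skew; have sk := prefork_skew Br.
have diag i : B' i i = 0 by have := sk' i i; lia.
have ab := prefork_abundant Br; have T := prefork_trans Br.
have Q := quiver_mut_return; have P := quiver_mut_acyclic.
split=> //.
- move=> i j ij.
  have [ik|ik] := eqVneq i k; first by subst i; rewrite quiver_mutl normrN ab.
  have [jk|jk] := eqVneq j k; first by subst j; rewrite quiver_mutr normrN ab.
  have [ir|ir] := eqVneq i r.
    by subst i; have [] := Q j; rewrite // eq_sym.
  have [jr|jr] := eqVneq j r.
    by subst j; have [] := Q i ir ik; rewrite sk' normrN.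
  have [-> _] := P i j ir jr ik jk ij.
  by rewrite (le_trans (ab _ _ ij)) // lerDl le_max lexx orbT.
- move=> i j l ik jk lk ij jl.
  have nij : i != j by apply: contraTneq ij => ->; rewrite diag.
  have njl : j != l by apply: contraTneq jl => ->; rewrite diag.
  have nil : i != l by apply: contraTneq ij => ->; rewrite sk'; lia.
  have [ir|ir] := eqVneq i r.
    subst i.
    have jr : j != r by rewrite eq_sym.
    have lr : l != r by rewrite eq_sym.
    by move: ij; have [_ ->] := Q j jr jk; have [_ ->] := Q l lr lk.
  have [jr|jr] := eqVneq j r.
    subst j; rewrite sk' in ij.
    have lr : l != r by rewrite eq_sym.
    have := ab _ _ kr; have [_] := Q i ir ik; have [_] := Q l lr lk.
    by lia.
  have [lr|lr] := eqVneq l r.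
    subst l; rewrite sk' in jl; rewrite sk'.
    have [a1 Q1] := Q i ir ik; have [a2 Q2] := Q j jr jk.
    by move: ij; have [_ ->] := P i j ir jr ik jk nij; lia.
  move: ij jl; have [_ ->] := P i j ir jr ik jk nij.
  have [_ ->] := P j l jr lr jk lk njl.
  by have [_ ->] := P i l ir lr ik lk nil; apply: T.
- move=> i j; rewrite quiver_mutl quiver_mutr => ki jk.
  have ik : i != k by apply: contraTneq ki => ->; rewrite (skew_diag _ sk).
  have njk : j != k by apply: contraTneq jk => ->; rewrite (skew_diag _ sk).
  have nij : j != i by apply: contraTneq ki => <-; rewrite sk; lia.
  rewrite quiver_mutE //.
  have := ab _ _ ik; have := ab _ _ nij; have := ab _ _ njk.
  (* Here [j -> k -> i]. If also [i -> j], the oriented triangle contains [r], and its side opposite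
     [r] is strictly the longest. That side ends at [k], so twice its length minus [B i j] still
     exceeds both sides at [k]. *)
  have : 0 < B j i \/ B k i > B i j /\ B k i > B j k \/ B j k > B i j /\ B j k
    > B k i.
    have [ir|ir] := eqVneq i r.
      subst i; have := prefork_return Br (i := k) (j := j).
      have := prefork_return Br (i := j) (j := k).
      by have := ab _ _ nij; have := sk j r; have := sk k r; have := sk j k;
        lia.
    have [jr|jr] := eqVneq j r.
      subst j; have := prefork_return Br (i := i) (j := k).
      by have := ab _ _ nij; have := sk i r; have := sk k r; have := sk i k;
        lia.
    by left; apply: (T j k i) => //; have := sk k i; have := sk j k; lia.
  move: ki jk; have := sk j i; have := sk k i; have := sk j k.
  move: (B i j) (B j i) (B i k) (B k i) (B k j) (B j k) => x x' y y' z z' -> ->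
    ->.
  nia.
Qed.

End Prefork.

(** * Sign-coherence of the c-vectors *)

(** Coherence of row [k] makes the choice made by the maximum uniform in the columns, so mutation
    becomes a row operation. *)
Lemma coef_mutE n (B C : 'M[int]_n) (k : 'I_n) (s : int) i j :
    s = 1 \/ s = -1 -> (forall l, 0 <= s * C k l) -> i != k ->
  coef_mut B C k i j =
    C i j + (if 0 < s * B i k then `|B i k| * C k j else 0).
Proof.
move=> sP /(_ j) Ckj ik; rewrite mxE (negbTE ik); congr (_ + _); move: Ckj.
move: (B i k) (C k j) => x y; case: sP => ->; rewrite ?mulN1r ?mul1r.
  by case: ifP => /=; nia.
by case: ifP => /=; nia.
Qed.

Lemma vsgn_coherent n (v : 'rV[int]_n) (s : int) :
  s = 1 \/ s = -1 -> v != 0 -> (forall j, 0 <= s * v 0 j) -> vsgn v = s.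
Proof.
move=> sP v0 vs; rewrite /vsgn (negbTE v0); case: sP vs => -> vs.
  by rewrite ifT //; apply/forallP => j; have := vs j; rewrite mul1r.
have vN : forall j, v 0 j <= 0 by move=> j; have := vs j; lia.
rewrite ifF ?ifT //; first exact/forallP.
apply/negbTE; apply: contra v0 => /forallP vp; apply/eqP/rowP => j.
by rewrite mxE; apply/eqP; rewrite eq_le vN vp.
Qed.

(* Off the point of return the positive rows come before the negative ones.
   Unless no mutation has happened yet, the row of [r] is dominated by every
   row to which it could be added with a cancellation. *)
Record coherent n (B C : 'M[int]_n) (r : 'I_n) (s : 'I_n -> int) : Prop :=
  Coherent {
  coherent_pm1 : forall i, s i = 1 \/ s i = -1;
  coherent_neq0 : forall i, row i C != 0;
  coherent_sign : forall i j, 0 <= s i * C i j;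
  coherent_order : forall i j, i != r -> j != r ->
    0 < s j * B i j -> s i = s j;
  coherent_dominate : (forall i, s i = 1) \/
    (forall i, i != r -> s r * B r i < 0 ->
       s i = - s r /\ forall j, `|C r j| <= `|C i j|) }.

Lemma row_neq0P n (C : 'M[int]_n) i :
  reflect (exists j, C i j != 0) (row i C != 0).
Proof.
apply: (iffP idP) => [|[j]].
  by case/rV0Pn => j; rewrite mxE; exists j.
by apply: contraNneq => /rowP/(_ j); rewrite !mxE => ->.
Qed.

Lemma coherent_mut n (B C : 'M[int]_n) (r k : 'I_n) (s : 'I_n -> int) :
  prefork B r -> k != r -> coherent B C r s ->
  exists s', coherent (quiver_mut B k) (coef_mut B C k) k s'.
Proof.
move=> Br kr [pm nz sgC ord dom].
have rk : r != k by rewrite eq_sym.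
have CE i j : i != k -> coef_mut B C k i j =
    C i j + (if 0 < s k * B i k then `|B i k| * C k j else 0).
  by move=> ik; apply: coef_mutE (pm k) _ ik => l; apply: sgC.
have Ckk j : coef_mut B C k k j = - C k j by rewrite mxE eqxx.
have ab := prefork_abundant Br; have sk := prefork_skew Br.
(* A row off [r] that receives a multiple of row [k] already has its sign, by [coherent_order]; only
   the rows [k] and [r] can change sign. *)
pose s' i := if i == k then - s k
  else if (i == r) && (0 < s k * B r k) then s k else s i.
have s'k : s' k = - s k by rewrite /s' eqxx.
have s'i i : i != k -> i != r -> s' i = s i.
  by move=> ik ir; rewrite /s' (negbTE ik) (negbTE ir).
have s'r : s' r = if 0 < s k * B r k then s k else s r.
  by rewrite /s' (negbTE rk) eqxx.
have gain i : i != k -> 0 < s k * B i k ->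
    s' i = s k /\ forall j, `|C k j| <= `|coef_mut B C k i j| /\
      0 <= s k * coef_mut B C k i j.
  move=> ik ki; have aik := ab _ _ ik.
  have [e|e] : s i = s k \/ (i == r) /\ s i = - s k.
  - have [ir|ir] := eqVneq i r; last by left; apply: ord.
    by have := pm i; have := pm k; lia.
  - split=> [|j].
      by have [ir|ir] := eqVneq i r; [subst i; rewrite s'r ki | rewrite s'i].
    rewrite CE // ki; have := sgC i j; have := sgC k j; rewrite e.
    by case: (pm k) => ->; rewrite ?mulN1r ?mul1r; nia.
  (* The one cancellation: row [r] has the opposite sign but is dominated by row [k], and [|B r k|]
     is at least 2, so the sum has the sign of row [k] and still dominates it. *)
  - case: e => /eqP ir e; subst i; rewrite s'r ki; split=> // j.
    have [sk1 Ck] : s k = - s r /\ forall j, `|C r j| <= `|C k j|.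
      case: dom => [a|]; first by have := a r; have := a k; lia.
      by apply=> //; move: ki; rewrite e; lia.
    rewrite CE // ki; have := sgC r j; have := sgC k j; have := Ck j; rewrite e.
    by case: (pm k) => ->; rewrite ?mulN1r ?mul1r ?opprK; nia.
have keep i : i != k -> ~~ (0 < s k * B i k) ->
    s' i = s i /\ forall j, coef_mut B C k i j = C i j.
  move=> ik /negbTE ki; split=> [|j]; last by rewrite CE // ki addr0.
  have [ir|ir] := eqVneq i r; last by rewrite s'i.
  by subst i; rewrite s'r ki.
have Q := quiver_mut_return Br kr; have P := quiver_mut_acyclic Br kr.
exists s'; split.
- move=> i; rewrite /s'; have := pm k; have := pm i.
  by case: ifP => _; [lia | case: ifP].
- move=> i; have [ik|ik] := eqVneq i k.
    subst i; apply/row_neq0P; have /row_neq0P[j Cj] := nz k; exists j.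
    by rewrite Ckk oppr_eq0.
  have [ki|ki] := boolP (0 < s k * B i k).
    have [_ g] := gain i ik ki; have /row_neq0P[j Cj] := nz k.
    by apply/row_neq0P; exists j; have [] := g j; lia.
  have [_ g] := keep i ik ki; have /row_neq0P[j Cj] := nz i.
  by apply/row_neq0P; exists j; rewrite g.
- move=> i j; have [ik|ik] := eqVneq i k.
    by subst i; rewrite s'k Ckk mulrNN.
  have [ki|ki] := boolP (0 < s k * B i k).
    by have [-> g] := gain i ik ki; have [] := g j.
  by have [-> ->] := keep i ik ki.
- move=> i j ik jk sij.
  have nij : i != j.
    apply: contraTneq sij => ->.
    by rewrite (skew_diag _ (quiver_mut_skew Br kr)) mulr0.
  (* Unless all signs [s] are 1, [s' r] is the sign of [B r k], which [quiver_mut_return] shows to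
     be the direction of all mutated arrows from [r] to vertices other than [k]. *)
  have [ir|ir] := eqVneq i r.
    subst i; have jr : j != r by rewrite eq_sym.
    move: sij; rewrite s'i // s'r; have [b1 Qj] := Q j jr jk.
    have := pm r; have := pm j; have := pm k.
    case: ifP => ki; last first.
      case: dom => [a|]; first by rewrite !a.
      by move/(_ k kr); have := ab _ _ rk; nia.
    by have := ab _ _ rk; nia.
  have [jr|jr] := eqVneq j r.
    subst j; move: sij; rewrite (s'i i) // s'r (quiver_mut_skew Br kr r i).
    have [b1 Qi] := Q i ir ik; have := pm r; have := pm i; have := pm k.
    case: ifP => ki; last first.
      case: dom => [a|]; first by rewrite !a.
      by move/(_ k kr); have := ab _ _ rk; nia.
    by have := ab _ _ rk; nia.
  have [_ Pij] := P i j ir jr ik jk nij; rewrite !s'i // in sij *.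
  apply: ord => //; have := pm j; have := ab _ _ nij.
  by case: (pm j) sij => ->; rewrite ?mulN1r ?mul1r; lia.
(* The rows concerned are those that have just received a multiple of row [k], so [gain] gives the
   domination. *)
- right=> i ik; rewrite s'k quiver_mutl => ki.
  have ki' : 0 < s k * B i k by rewrite sk in ki; lia.
  have [-> g] := gain i ik ki'; rewrite opprK; split=> // j.
  by rewrite Ckk normrN; have [] := g j.
Qed.

(** * Mutation of GIMs up to signs of basis vectors *)

(* [gim_of] for any linear order that starts at [r] and continues with the
   complement of [r] listed against the arrows. *)
Definition gim_at n (B : 'M[int]_n) (r i j : 'I_n) : int :=
  if i == j then 2 else if i == r then B r j
  else if j == r then B r i else - `|B i j|.

Lemma gim_atC n (B : 'M[int]_n) r i j :
  skew_symmetric B -> gim_at B r i j = gim_at B r j i.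
Proof.
move=> sk; rewrite /gim_at eq_sym (sk j i) normrN.
by case: (eqVneq j i); case: (eqVneq i r); case: (eqVneq j r) => // -> ->.
Qed.

Lemma norm_gim_at n (B : 'M[int]_n) r i j :
  skew_symmetric B -> i != j -> `|gim_at B r i j| = `|B i j|.
Proof.
move=> sk ij; rewrite /gim_at (negbTE ij).
have [->//|_] := eqVneq i r; have [->|_] := eqVneq j r;
  last by rewrite normrN normr_id.
by rewrite (sk i r) normrN.
Qed.

Definition gim_sim n (B A : 'M[int]_n) (r : 'I_n) (e : 'I_n -> int) : Prop :=
  (forall i, e i = 1 \/ e i = -1) /\
  (forall i j, A i j = e i * e j * gim_at B r i j).

Lemma gim_mutateC n (B C A : 'M[int]_n) k i j :
  skew_symmetric B -> (forall x y, A x y = A y x) ->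
  gim_mutate B C A k i j = gim_mutate B C A k j i.
Proof.
move=> sk AC; rewrite !mxE.
have [->|ik] := eqVneq i k; have [->|jk] //= := eqVneq j k.
- by rewrite (AC j k).
- by rewrite (AC i k).
- by rewrite (AC i j) (sk k i) (sk j k) mulrNN (mulrC (B k i)) (AC i k) (AC k
  j) (mulrC (A k i)).
Qed.

Lemma gim_mut n (B C A : 'M[int]_n) (r k : 'I_n) (e : 'I_n -> int) :
  prefork B r -> k != r -> vsgn (row k C) = 1 \/ vsgn (row k C) = -1 ->
  gim_sim B A r e ->
  exists e', gim_sim (quiver_mut B k) (gim_mutate B C A k) k e'.
Proof.
move=> Br kr; move Es : (vsgn (row k C)) => s sP [eP AE].
have sk := prefork_skew Br; have ab := prefork_abundant Br.
have sk' := quiver_mut_skew Br kr.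
have rk : r != k by rewrite eq_sym.
have AC x y : A x y = A y x by rewrite !AE gim_atC // (mulrC (e x)).
have ee x : e x * e x = 1 by case: (eP x) => ->.
(* The sign of [c_k] multiplies all of row [k] off the diagonal and is absorbed in [e' k]. Entries
   at [r] pass from the form [B r j] to the form [- |B r j|]; after mutation they share the sign of
   [B r k], which goes into [e' r]. *)
pose e' i := if i == k then s * e k
  else if i == r then - (Num.sg (B r k) * e r) else e i.
have e'k : e' k = s * e k by rewrite /e' eqxx.
have e'r : e' r = - (Num.sg (B r k) * e r) by rewrite /e' (negbTE rk) eqxx.
have e'i i : i != k -> i != r -> e' i = e i.
  by move=> ik ir; rewrite /e' (negbTE ik) (negbTE ir).
have sgB : Num.sg (B r k) = 1 \/ Num.sg (B r k) = -1.
  by have := ab _ _ rk; lia.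
have e'P i : e' i = 1 \/ e' i = -1.
  rewrite /e'; case: ifP => _; first by case: sP => ->; case: (eP k) => ->; lia.
  by case: ifP => _ //; case: sgB => ->; case: (eP r) => ->; lia.
have ee' x : e' x * e' x = 1 by case: (e'P x) => ->.
have col j : j != k -> gim_mutate B C A k k j = e' k * e' j * gim_at
  (quiver_mut B k) k k j.
  move=> jk; rewrite mxE eqxx jk /= Es AE /gim_at eq_sym (negbTE jk) (negbTE
    kr) eqxx.
  rewrite quiver_mutl e'k.
  have [jr|jr] := eqVneq j r.
    by subst j; rewrite e'r (sk r k) opprK; ring.
  by rewrite e'i // (sk k j) sgrN [in RHS](numEsg (B k j)); ring.
exists e'; split=> // i j.
have [->|ik] := eqVneq i k.
  have [->|jk] := eqVneq j k; last exact: col.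
  by rewrite mxE eqxx /= (skew_diag _ sk) mul0r maxxx mulr0 subr0 AE /gim_at
    eqxx ee ee'.
have [jk|jk] := eqVneq j k.
  by subst j; rewrite gim_mutateC // gim_atC // (mulrC (e' i)); apply: col.
have sgN x y : x != y -> Num.sg (- `|B x y|) = -1.
  by move=> xy; rewrite ltr0_sg // oppr_lt0 (lt_le_trans _ (ab _ _ xy)).
(* For [x = r] the GIM rule is exactly quiver mutation of [B r y]. Off [r] the product of the two
   entries at [k] has sign [e x * e y], so the new arrows add to the absolute value as in
   [quiver_mut_acyclic]. *)
have main x y : x != k -> y != k -> x != y -> y != r ->
    gim_mutate B C A k x y = e' x * e' y * gim_at (quiver_mut B k) k x y.
  move=> xk yk xy yr; have ky : k != y by rewrite eq_sym.
  rewrite mxE (negbTE xk) (negbTE yk) !AE /=.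
  have -> : Num.sg (e x * e k * gim_at B r x k * (e k * e y * gim_at B r k y)) =
      e x * e y * (Num.sg (gim_at B r x k) * Num.sg (gim_at B r k y)).
    have -> z t : e x * e k * z * (e k * e y * t) = e x * e y * (z * t).
      by rewrite -[RHS]mul1r -(ee k); ring.
    by rewrite !sgrM; case: (eP x) => ->; case: (eP y) => ->;
      rewrite ?sgrN sgr1.
  rewrite /gim_at (negbTE xk) (negbTE yk) (negbTE kr) (negbTE xy) (negbTE ky)
    (negbTE yr).
  rewrite (sgN k y) //.
  have [xr|xr] := eqVneq x r.
    subst x; rewrite e'r e'i //.
    have -> : - (Num.sg (B r k) * e r) * e y * - `|quiver_mut B k r y| =
        e r * e y * (Num.sg (B r k) * `|quiver_mut B k r y|) by ring.
    have -> : Num.sg (B r k) * `|quiver_mut B k r y| = quiver_mut B k r y.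
      by have := quiver_mut_return Br kr yr yk; have := ab _ _ rk; lia.
    by rewrite (quiver_mutE B rk yk); ring.
  rewrite !e'i // (quiver_mut_acyclic Br kr xr yr xk yk xy).1.
  by rewrite sgN //; ring.
have [->|ij] := eqVneq i j.
  rewrite mxE (negbTE jk) /= AE /gim_at eqxx ee ee' (sk j k) mulrN.
  by rewrite (max_idPr _) ?mulr0 ?subr0 // oppr_le0 -expr2 sqr_ge0.
have [jr|jr] := eqVneq j r; last exact: main.
have ji : j != i by rewrite eq_sym.
have ir : i != r by rewrite -jr.
by rewrite gim_mutateC // gim_atC // (mulrC (e' i)); apply: main.
Qed.

(** * Admissibility of the normal form *)

(** In a longer cycle the first and third vertices are joined by a chord. *)
Lemma chordless_cycle_size n (B : 'M[int]_n) (s : seq 'I_n) :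
  abundant B -> chordless_cycle B s -> size s = 3.
Proof.
move=> ab [].
case: s => [|x [|y [|z [|t s]]]] //= _ /andP[_ /=].
rewrite !inE !negb_or => /andP[/and4P[xy xz xt _] /andP[/and3P[yz _ _]
  /andP[/andP[zt _] _]]].
have adj : adjacent B x z.
  by rewrite /adjacent -normr_gt0 (lt_le_trans _ (ab _ _ xz)).
move=> /(_ x z); rewrite !inE !eqxx !orbT !(eq_sym z) (negbTE xz) (negbTE yz).
by case=> // e; [move: yz | move: xt]; rewrite e eqxx.
Qed.

Section Triangle.
Variables (n : nat) (B : 'M[int]_n) (r : 'I_n).
Hypothesis Br : prefork B r.
Let g := gim_at B r.

Let triangle x y z := if [&& 0 < B x y, 0 < B y z & 0 < B z x] ||
    [&& 0 < B z y, 0 < B y x & 0 < B x z]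
  then (- g x y) * (- g y z) * (- g z x) < 0
  else 0 < (- g x y) * (- g y z) * (- g z x).

Let triangle_rot x y z : triangle x y z -> triangle y z x.
Proof.
rewrite /triangle -(mulrA (- g x y)) (mulrC (- g x y)).
by case: (0 < B x y); case: (0 < B y z); case: (0 < B z x);
  case: (0 < B z y); case: (0 < B y x); case: (0 < B x z).
Qed.

(** A triangle off [r] is not oriented and all its factors are positive. Through [r] the product is
    [B r y * B r z * |B y z|], negative exactly when [r] is neither source nor sink of the triangle;
    by the return inequalities it is then oriented. *)
Lemma gim_at_triangle x y z : x != y -> y != z -> z != x -> triangle x y z.
Proof.
have sk := prefork_skew Br; have ab := prefork_abundant Br.
have at_r y' z' : r != y' -> y' != z' -> z' != r -> triangle r y' z'.
  move=> ry yz zr; have yr : y' != r by rewrite eq_sym.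
  have rz : r != z' by rewrite eq_sym.
  have zy : z' != y' by rewrite eq_sym.
  rewrite /triangle /g /gim_at !eqxx (negbTE ry) (negbTE yz) (negbTE zr)
    (negbTE yr).
  have := prefork_return Br (i := y') (j := z').
  have := prefork_return Br (i := z') (j := y').
  have := ab _ _ ry; have := ab _ _ yz; have := ab _ _ rz.
  rewrite (sk r y') (sk y' z') (sk r z').
  move: (B r y') (B y' z') (B r z') => u v w.
  rewrite opprK => w2 v2 u2 h1 h2.
  have -> : - u * `|v| * - w = u * w * `|v| by ring.
  have vp : 0 < `|v| by exact: lt_le_trans v2.
  rewrite (pmulr_llt0 _ vp) (pmulr_lgt0 _ vp).
  by case: ifP => /=; nia.
move=> xy yz zx.
have [e|xr] := eqVneq x r; first by rewrite e in xy zx *; apply: at_r.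
have [e|yr] := eqVneq y r.
  by rewrite e in xy yz *; do 2!apply: triangle_rot; apply: at_r.
have [e|zr] := eqVneq z r.
  by rewrite e in yz zx *; apply: triangle_rot; apply: at_r.
have T := prefork_trans Br.
rewrite /triangle ifF.
  rewrite /g /gim_at (negbTE xy) (negbTE yz) (negbTE zx) (negbTE xr) (negbTE
    yr) (negbTE zr).
  by rewrite !opprK !mulr_gt0 // (lt_le_trans _ (ab _ _ _)).
apply/negbTE/negP => /orP[] /and3P[p q t].
  by have := T _ _ _ xr yr zr p q; move: t; rewrite (sk x z); lia.
by have := T _ _ _ zr yr xr p q; move: t; rewrite (sk z x); lia.
Qed.

End Triangle.

Lemma prefork_admissible n (B A : 'M[int]_n) (r : 'I_n) (e : 'I_n -> int) :
  prefork B r -> gim_sim B A r e -> admissible B A.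
Proof.
move=> Br [eP AE]; have sk := prefork_skew Br; have ab := prefork_abundant Br.
have AC x y : A x y = A y x by rewrite !AE gim_atC // (mulrC (e x)).
have ee x : e x * e x = 1 by case: (eP x) => ->.
split.
- split=> [i|i j|i j]; try by rewrite AC.
  by rewrite AE ee mul1r /gim_at eqxx.
- by apply/matrixP => i j; rewrite mxE AC.
- move=> i j ij; rewrite AE !normrM (norm_gim_at _ sk ij).
  by case: (eP i) => ->; case: (eP j) => ->; rewrite ?normrN normr1 !mul1r.
- move=> s sB; have := chordless_cycle_size ab sB; have [_ + _] := sB.
  case: s sB => [|x [|y [|z [|t s]]]] //= _ /andP[_ /=].
  rewrite !inE !negb_or andbT => /andP[/andP[xy xz] yz] _.
  have zx : z != x by rewrite eq_sym.
  have := gim_at_triangle Br xy yz zx.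
  rewrite !big_cons big_nil /= !eqxx !(eq_sym _ x) (eq_sym z y).
  rewrite (negbTE xy) (negbTE xz) (negbTE yz) mulr1.
  rewrite /oriented /rev /= /arrow !andbT.
  (* Each basis sign occurs twice around the triangle. *)
  have -> : - A x y * (- A y z * - A z x) =
      - gim_at B r x y * - gim_at B r y z * - gim_at B r z x.
    rewrite !AE.
    by case: (eP x) => ->; case: (eP y) => ->; case: (eP z) => ->; ring.
  by [].
Qed.

(** * Induction along the mutation sequence and its initial data *)

Lemma admissible_mutations n (w : seq 'I_n) (M : 'M[int]_(n, n + n))
    (A : 'M[int]_n) (r : 'I_n) (s e : 'I_n -> int) :
  prefork (lsubmx M) r -> coherent (lsubmx M) (rsubmx M) r s ->
  gim_sim (lsubmx M) A r e -> fork_preserving r w ->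
  admissible (lsubmx (foldl (@mutate n) M w)) (gim_mutations M A w).
Proof.
elim: w M A r s e => [|k w IHw] M A r s e Br Cs Ae /=.
  by move=> _; apply: prefork_admissible Br Ae.
move=> /andP[kw kr'].
have kr : k != r by apply: contra kr' => /eqP ->.
have vk : vsgn (row k (rsubmx M)) = s k.
  apply: vsgn_coherent; [exact: coherent_pm1 Cs k | exact: coherent_neq0 Cs k|].
  by move=> j; rewrite mxE; apply: coherent_sign Cs k j.
have vP : vsgn (row k (rsubmx M)) = 1 \/ vsgn (row k (rsubmx M)) = -1.
  by rewrite vk; apply: coherent_pm1 Cs k.
have [s' Cs'] := coherent_mut Br kr Cs; have [e' Ae'] := gim_mut Br kr vP Ae.
rewrite -rsubmx_mutate -lsubmx_mutate in Cs'; rewrite -lsubmx_mutate in Ae'.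
apply: IHw Cs' Ae' _; first by rewrite lsubmx_mutate; apply: prefork_mut Br kr.
(* Reducedness says precisely that the next mutation avoids [k], the new point of return. *)
rewrite /fork_preserving; move: kw; rewrite /reduced /=.
by case: w kr' => [|l w] //= _ /andP[kl ->]; apply: contra kl => /eqP[->].
Qed.

Lemma index_rev (T : eqType) (s : seq T) x : uniq s -> x \in s ->
  index x (rev s) = (size s - (index x s).+1)%N.
Proof.
move=> us xs; have lt := xs; rewrite -index_mem in lt.
set m := (size s - _)%N; have mlt : (m < size s)%N by rewrite /m; lia.
have <- : nth x (rev s) m = x.
  rewrite nth_rev // -[RHS](nth_index x xs); congr nth; rewrite /m; lia.
by rewrite index_uniq ?rev_uniq ?size_rev.
Qed.

(** The listing is a topological order off [r], and in an abundant quiver this forces transitivity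
    of the arrows. *)
Lemma fork_prefork n (B : 'M[int]_n) r a :
  fork B r -> source_listing B r a -> prefork B r.
Proof.
move=> [sk ab _ ret _] [ua aE lt]; split=> // [i j l ir jr lr ij jl|i j ir rj].
  have ina x : x != r -> x \in a by rewrite aE.
  have lij := lt _ _ (ina _ ir) (ina _ jr) ij.
  have ljl := lt _ _ (ina _ jr) (ina _ lr) jl.
  have il : i != l by apply: contraTneq (ltn_trans lij ljl) => ->; rewrite ltnn.
  have [//|li|e] := ltgtP; last by have := ab _ _ il; rewrite -e normr0.
  have lli : (index l a < index i a)%N.
    by apply: lt; rewrite ?ina // /arrow sk oppr_gt0.
  by have := ltn_trans (ltn_trans lij ljl) lli; rewrite ltnn.
by apply: ret; rewrite inE.
Qed.

(** The reversed listing puts the head of each arrow before its tail, so all off-diagonal entries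
    away from [r] are negative. *)
Lemma gim_of_source_listing n (B : 'M[int]_n) r a :
  fork B r -> source_listing B r a ->
  gim_sim B (gim_of B (seq_order (r :: rev a))) r (fun=> 1).
Proof.
move=> [sk ab _ _ _] [ua aE lt]; split=> [i|i j]; first by left.
rewrite !mul1r mxE /gim_at /seq_order /=; case: eqVneq => // ij.
have ina x : x != r -> x \in a by rewrite aE.
rewrite !(eq_sym r).
have [ir|ir] := eqVneq i r.
  by subst i; rewrite eq_sym (negbTE ij).
have [jr|jr] := eqVneq j r; first by subst j; rewrite -sk.
rewrite ltnS !index_rev ?ina //.
have := ina _ ir; have := ina _ jr; rewrite -!index_mem => ja ia.
have [p|p|e] := ltgtP 0 (B i j); last by have := ab _ _ ij; rewrite -e normr0.
  have := lt _ _ (ina _ ir) (ina _ jr) p => h.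
  by rewrite ifF ?gtr0_norm //; lia.
have h : (index j a < index i a)%N.
  by apply: lt; rewrite ?ina // /arrow sk oppr_gt0.
by rewrite ifT ?ltr0_norm ?opprK //; lia.
Qed.

Lemma coherent_framed n (B : 'M[int]_n) r : coherent B 1%:M r (fun=> 1).
Proof.
split=> // [i|i|i j|]; try by left.
  by apply/row_neq0P; exists i; rewrite mxE eqxx oner_eq0.
by rewrite mul1r mxE ler0n.
Qed.

Theorem theorem1p12 (n : nat) (n_gt0 : (0 < n)%N) (B : 'M[int]_n) (r : 'I_n)
    (a : seq 'I_n) (B_fork : fork B r) (a_list : source_listing B r a)
    (w : seq 'I_n) (w_fp : fork_preserving r w) :
  admissible (Bmut B w) (Amut B (gim_of B (seq_order (r :: rev a))) w).
Proof.
apply: (@admissible_mutations _ _ _ _ r (fun=> 1) (fun=> 1)) w_fp;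
  rewrite /framed row_mxKl.
- exact: fork_prefork a_list.
- by rewrite row_mxKr; apply: coherent_framed.
- exact: gim_of_source_listing.
Qed.
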